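(* Let $K=\mathbb{F}_q$ be a finite field with $q\neq 2$, let $\mathcal{C}$ be a clutter with vertex set $V_{\mathcal C}=\{y_1,\ldots,y_n\}$ and edge set $E_{\mathcal C}$, and let $X\subset\mathbb{P}^{s-1}$ and $Y\subset\mathbb{P}^{s}$ be the associated sets parameterized by the edges of $\mathcal{C}$ (defined in the context). Then: (i) $|Y|\leq (q-1)|X|$. (ii) If there is $A\subset V_{\mathcal C}$ such that $|A\cap e|=1$ for every $e\in E_{\mathcal C}$, then $|Y|=(q-1)|X|$. (iii) If $k\geq 2$ is an integer, $\mathcal{C}$ is $k$-uniform (all its edges have cardinality $k$) and $\gcd(q-1,k)=1$, then $|Y|=(q-1)|X|$.
   Context: A clutter $\mathcal{C}$ is a family $E_{\mathcal C}$ of subsets (edges) of a finite vertex set $V_{\mathcal C}=\{y_1,\ldots,y_n\}$ such that no edge is contained in a different edge. Let $f_1,\ldots,f_s$ ($s\geq 1$) be the edges of $\mathcal{C}$ and let $v_i=\sum_{y_j\in f_i}e_j\in\{0,1\}^n$ be the characteristic vector of $f_i$. Put $K^*=K\setminus\{0\}$ and, for $x=(x_1,\ldots,x_n)\in (K^* )^n$, $x^{v_i}=x_1^{v_{i1}}\cdots x_n^{v_{in}}$. Define $X=\{[(x^{v_1},\ldots,x^{v_s})] : x\in (K^* )^n\}\subset\mathbb{P}^{s-1}$ and $Y=\{[(x^{v_1},\ldots,x^{v_s},1)] : x\in (K^* )^n\}\subset\mathbb{P}^{s}$, projective spaces over $K$. *)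

(* Defs.v *)
From HB Require Import structures.
From mathcomp Require Import all_boot all_order all_algebra.

Set Implicit Arguments.
Unset Strict Implicit.
Unset Printing Implicit Defensive.

Import GRing.Theory.
Local Open Scope ring_scope.

(* The vertex y_j is represented by its index j : 'I_n. *)
Definition clutter (n : nat) (E : {set {set 'I_n}}) : Prop :=
  forall e e', e \in E -> e' \in E -> e \subset e' -> e = e'.

Definition char_vec (n : nat) (e : {set 'I_n}) : 'rV[nat]_n :=
  \row_(j < n) (j \in e : nat).

Definition monomial (K : fieldType) (n : nat) (x : 'rV[K]_n) (v : 'rV[nat]_n) : K :=
  \prod_(j < n) x 0 j ^+ v 0 j.

Definition torus (K : finFieldType) (n : nat) : {set 'rV[K]_n} :=
  [set x : 'rV[K]_n | [forall j, x 0 j != 0]].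

Section ProjectiveSpace.
Variables (K : finFieldType) (m : nat).

Definition proj_equiv (u w : 'rV[K]_m) : bool :=
  [exists a : K, (a != 0) && (w == a *: u)].

(* This is P^(m-1) over K: m is the number of homogeneous coordinates. *)
Definition proj_space : {set {set 'rV[K]_m}} :=
  equivalence_partition proj_equiv [set u : 'rV[K]_m | u != 0].

(* [u], as a set of vectors; an element of proj_space when u != 0. *)
Definition proj_point (u : 'rV[K]_m) : {set 'rV[K]_m} :=
  [set w | proj_equiv u w].

Lemma proj_point_in (u : 'rV[K]_m) : u != 0 -> proj_point u \in proj_space.
Proof.
move=> u0; apply/imsetP; exists u; first by rewrite inE.
apply/setP=> w; rewrite !inE; case uw: (proj_equiv u w); last by rewrite andbF.
by case/existsP: uw => a /andP[a0 /eqP->]; rewrite scaler_eq0 negb_or a0 u0.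
Qed.

Lemma proj_equiv_equivalence : equivalence_rel proj_equiv.
Proof.
have refl u : proj_equiv u u.
  by apply/existsP; exists 1; rewrite oner_eq0 scale1r eqxx.
move=> u v w; split=> // /existsP[a /andP[a0 /eqP->]].
apply/existsP/existsP=> -[b /andP[b0 /eqP->]].
  by exists (b / a); rewrite mulf_neq0 ?invr_eq0 // scalerA divfK ?eqxx.
by exists (b * a); rewrite mulf_neq0 // scalerA eqxx.
Qed.

End ProjectiveSpace.

Section ParameterizedSets.
Variables (K : finFieldType) (n s : nat) (f : 'I_s -> {set 'I_n}).

Definition param_vec (x : 'rV[K]_n) : 'rV[K]_s :=
  \row_(i < s) monomial x (char_vec (f i)).

Definition setX_of : {set {set 'rV[K]_s}} :=
  [set proj_point (param_vec x) | x in torus K n].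

Definition setY_of : {set {set 'rV[K]_(s + 1)}} :=
  [set proj_point (row_mx (param_vec x) (const_mx 1)) | x in torus K n].

Lemma monomial_neq0 (x : 'rV[K]_n) v : x \in torus K n -> monomial x v != 0.
Proof.
rewrite inE => /forallP x0; apply/prodf_neq0 => j _; exact: expf_neq0.
Qed.

Lemma setX_of_sub : (0 < s)%N -> setX_of \subset proj_space K s.
Proof.
move=> s0; apply/subsetP=> _ /imsetP[x xT ->]; apply: proj_point_in.
apply/eqP=> /rowP/(_ (Ordinal s0)); rewrite !mxE.
by apply/eqP; exact: monomial_neq0.
Qed.

Lemma setY_of_sub : setY_of \subset proj_space K (s + 1).
Proof.
apply/subsetP=> _ /imsetP[x xT ->]; apply: proj_point_in.
apply/eqP=> /rowP/(_ (rshift s ord0)); rewrite row_mxEr !mxE.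
by apply/eqP; exact: oner_neq0.
Qed.

End ParameterizedSets.

Arguments setX_of K {n s} f.
Arguments setY_of K {n s} f.

(* Main.v *)
Require Import Defs.
From mathcomp Require Import all_boot all_order all_algebra finfield.

(** Normalizing the last coordinate to 1 identifies Y with the set P of affine
    vectors (x^v_1, ..., x^v_s), and X is the image of P in projective space.
    Each fibre of P -> X lies in a K^*-orbit, so it has at most q - 1 elements,
    with equality everywhere when P is stable under K^*. If a vertex set A meets
    every edge in k vertices with gcd(q - 1, k) = 1, then P is stable: multiplying
    x by b on A multiplies every x^v_i by b^k, and every element of K^* is a k-th
    power. Case (ii) is k = 1, and case (iii) is A = V. *)

Section Parameterized.
Set Implicit Arguments.
Unset Strict Implicit.
Import GRing.Theory.
Local Open Scope ring_scope.

Lemma proj_pointP (K : finFieldType) (m : nat) (u w : 'rV[K]_m) :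
  reflect (exists2 a : K, a != 0 & w = a *: u) (w \in proj_point u).
Proof.
rewrite inE; apply: (iffP existsP) => [[a /andP[a0 /eqP->]]|[a a0 ->]].
  by exists a.
by exists a; rewrite a0 eqxx.
Qed.

Lemma proj_point_refl (K : finFieldType) (m : nat) (u : 'rV[K]_m) :
  u \in proj_point u.
Proof. by apply/proj_pointP; exists 1; rewrite ?oner_eq0 ?scale1r. Qed.

Lemma proj_point_scale (K : finFieldType) (m : nat) (a : K) (u : 'rV[K]_m) :
  a != 0 -> proj_point (a *: u) = proj_point u.
Proof.
move=> a0; apply/setP=> w.
apply/proj_pointP/proj_pointP => -[b b0 ->].
  by exists (b * a); rewrite ?mulf_neq0 ?scalerA.
by exists (b / a); rewrite ?mulf_neq0 ?invr_eq0 // scalerA divfK.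
Qed.

(** Comparing last coordinates forces the proportionality scalar to be 1. *)
Lemma proj_point_affine_inj (K : finFieldType) (m : nat) :
  injective (fun u : 'rV[K]_m => proj_point (row_mx u (const_mx 1 : 'rV_1))).
Proof.
move=> u w uw.
have := proj_point_refl (row_mx w (const_mx 1 : 'rV_1)).
rewrite -uw => /proj_pointP[a _]; rewrite scale_row_mx => /eq_row_mx[-> /rowP].
by move=> /(_ 0); rewrite !mxE mulr1 => <-; rewrite scale1r.
Qed.

(** Bezout gives [u * k = v * (#|K| - 1) + 1]; since [a ^+ (#|K| - 1) = 1], the power [a ^+ u] is a
    [k]-th root of [a]. *)
Lemma finField_expf_surj (K : finFieldType) (k : nat) (a : K) :
  (0 < k)%N -> coprime (#|K| - 1) k -> a != 0 ->
  exists2 b : K, b != 0 & b ^+ k = a.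
Proof.
move=> k_gt0 cop a0.
have aq : a ^+ (#|K| - 1) = 1.
  apply: (mulfI a0); rewrite -exprS subn1 prednK ?mulr1 ?expf_card //.
  by apply/card_gt0P; exists a.
have [u v uv _] := egcdnP (#|K| - 1) k_gt0.
exists (a ^+ u); first exact: expf_neq0.
rewrite -exprM uv gcdnC (eqP cop) exprD mulnC exprM aq expr1n mul1r.
exact: expr1.
Qed.

Variables (K : finFieldType) (n s : nat) (f : 'I_s -> {set 'I_n}).

Definition affine_image : {set 'rV[K]_s} :=
  [set param_vec f x | x in torus K n].

Lemma setX_of_affine : setX_of K f = [set proj_point u | u in affine_image].
Proof. by rewrite -imset_comp. Qed.

Lemma card_setY_of : #|setY_of K f| = #|affine_image|.
Proof.
rewrite -(card_imset (mem affine_image) (@proj_point_affine_inj K s)).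
by rewrite -imset_comp.
Qed.

(** The chosen vector depends only on the class [c.2]. The default 0 is never reached on a
    [proj_point], which is nonempty. *)
Definition scaled_repr (c : K * {set 'rV[K]_s}) : 'rV[K]_s :=
  c.1 *: odflt 0 [pick w in c.2].

(** Through [scaled_repr], these pairs parameterize the punctured affine cone over X. *)
Definition cone_index : {set K * {set 'rV[K]_s}} :=
  setX [set~ 0] (setX_of K f).

Lemma card_cone_index : #|cone_index| = ((#|K| - 1) * #|setX_of K f|)%N.
Proof. by rewrite cardsX cardsC1 subn1. Qed.

Lemma scaled_reprE (a : K) (u : 'rV[K]_s) :
  exists2 b : K, b != 0 & scaled_repr (a, proj_point u) = (a * b) *: u.
Proof.
rewrite /scaled_repr /=; case: pickP => [w /proj_pointP[b b0 ->]|/(_ u)].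
  by exists b; rewrite //= scalerA.
by rewrite proj_point_refl.
Qed.

Lemma affine_image_sub : affine_image \subset scaled_repr @: cone_index.
Proof.
apply/subsetP=> u uP; have [b b0 ub] := scaled_reprE 1 u.
(* The chosen representative is [b *: u], so the scalar [b^-1] recovers [u]. *)
apply/imsetP; exists (b^-1, proj_point u).
  by rewrite in_setX !inE /= invr_eq0 b0 setX_of_affine; apply: imset_f.
move: ub; rewrite /scaled_repr /= scale1r mul1r => ->.
by rewrite scalerA mulVf ?scale1r.
Qed.

Lemma card_setY_of_le : (#|setY_of K f| <= (#|K| - 1) * #|setX_of K f|)%N.
Proof.
rewrite card_setY_of -card_cone_index.
exact: leq_trans (subset_leq_card affine_image_sub) (leq_imset_card _ _).
Qed.

Lemma affine_image_neq0 (u : 'rV[K]_s) :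
  (0 < s)%N -> u \in affine_image -> u != 0.
Proof.
move=> s0 /imsetP[x xT ->]; apply/eqP=> /rowP/(_ (Ordinal s0)).
by rewrite !mxE; apply/eqP; exact: monomial_neq0.
Qed.

Lemma scaled_repr_inj : (0 < s)%N -> {in cone_index &, injective scaled_repr}.
Proof.
move=> s0 [a C] [a' C']; rewrite !inE /= setX_of_affine.
move=> /andP[a0 /imsetP[u uP ->]] /andP[a'0 /imsetP[u' uP' ->]] eq_repr.
(* The common value is a nonzero multiple of both [u] and [u'], so the classes agree. *)
have CC' : proj_point u = proj_point u'.
  have [b b0 ub] := scaled_reprE a u; have [b' b'0 ub'] := scaled_reprE a' u'.
  rewrite -(proj_point_scale u (mulf_neq0 a0 b0)) -ub eq_repr ub'.
  by rewrite proj_point_scale ?mulf_neq0.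
(* Both pairs now share one representative [r], and [(a - a') *: r = 0]. If [r] were 0, so would be
   its multiple [u], whose coordinates are nonzero monomials. *)
rewrite -CC' in eq_repr *; congr pair; apply/eqP.
move/eqP: eq_repr; rewrite -subr_eq0 /scaled_repr /= -scalerBl scaler_eq0.
rewrite subr_eq0; case/orP=> // /eqP r0.
have [b b0] := scaled_reprE 1 u.
rewrite /scaled_repr /= r0 scaler0 mul1r => /eqP.
by rewrite eq_sym scaler_eq0 (negPf b0) (negPf (affine_image_neq0 s0 uP)).
Qed.

Lemma card_setY_of_stable : (0 < s)%N ->
  (forall (a : K) u, a != 0 -> u \in affine_image -> a *: u \in affine_image) ->
  #|setY_of K f| = ((#|K| - 1) * #|setX_of K f|)%N.
Proof.
move=> s0 stab; rewrite card_setY_of -card_cone_index.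
(* Stability supplies the reverse of [affine_image_sub]: the affine image is the whole punctured
   cone. *)
rewrite -(card_in_imset (scaled_repr_inj s0)); congr #|pred_of_set _|.
apply/eqP; rewrite eqEsubset affine_image_sub /=.
apply/subsetP=> _ /imsetP[[a C] + ->]; rewrite !inE /= setX_of_affine.
move=> /andP[a0 /imsetP[u uP ->]]; have [b b0 ->] := scaled_reprE a u.
by apply: stab => //; exact: mulf_neq0.
Qed.

Lemma monomial_scale_on (b : K) (x : 'rV[K]_n) (A e : {set 'I_n}) :
  monomial (\row_j ((if j \in A then b else 1) * x 0 j)) (char_vec e) =
    b ^+ #|A :&: e| * monomial x (char_vec e).
Proof.
(* The power of [b] becomes a product over all vertices, with factor 1 off [A :&: e], so the two
   sides are compared vertex by vertex. *)
rewrite /monomial -prodr_const [in RHS]big_mkcond -big_split /=.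
apply: eq_bigr => j _; rewrite !mxE exprMn inE; congr (_ * _).
by case: (j \in A); case: (j \in e); rewrite ?expr1n.
Qed.

Lemma card_setY_of_transversal (A : {set 'I_n}) (k : nat) :
  (0 < s)%N -> (0 < k)%N -> coprime (#|K| - 1) k ->
  (forall i, #|A :&: f i| = k) ->
  #|setY_of K f| = ((#|K| - 1) * #|setX_of K f|)%N.
Proof.
move=> s0 k0 cop Ak; apply: card_setY_of_stable => // a _ a0 /imsetP[x xT ->].
have [b b0 <-] := finField_expf_surj k0 cop a0.
apply/imsetP; exists (\row_j ((if j \in A then b else 1) * x 0 j)).
  move: xT; rewrite !inE => /forallP x0; apply/forallP=> j.
  by rewrite mxE mulf_neq0 //; case: ifP => // _; exact: oner_neq0.
by apply/rowP=> i; rewrite !mxE monomial_scale_on Ak.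
Qed.

End Parameterized.

Theorem proposition2p5 (K : finFieldType) (hK : #|K| <> 2)
  (n : nat) (E : {set {set 'I_n}}) (hE : clutter E)
  (s : nat) (hs : 0 < s)
  (f : 'I_s -> {set 'I_n}) (finj : injective f)
  (fE : E = [set f i | i : 'I_s]) :
  [/\ #|setY_of K f| <= (#|K| - 1) * #|setX_of K f|,
      (exists A : {set 'I_n}, forall e, e \in E -> #|A :&: e| = 1) ->
        #|setY_of K f| = (#|K| - 1) * #|setX_of K f|
    & forall k : nat, 2 <= k -> (forall e, e \in E -> #|e| = k) ->
        gcdn (#|K| - 1) k = 1 ->
        #|setY_of K f| = (#|K| - 1) * #|setX_of K f| ].
Proof.
have fiE i : f i \in E by rewrite fE imset_f.
split; first exact: card_setY_of_le.
  move=> [A A1]; apply: (card_setY_of_transversal (A := A) (k := 1)) => //.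
    exact: coprimen1.
  by move=> i; exact: A1.
move=> k k2 Ek /eqP cop.
apply: (card_setY_of_transversal (A := setT) (k := k)) => //.
  exact: ltnW.
by move=> i; rewrite setTI; exact: Ek.
Qed.
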